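(* Let $F$ be an arbitrary $n$-ary connective of $L$ given by a table of $R$-expression schemata $S_{ik}$ ($i=1,\dots,t$; $k=1,\dots,s_i$) built from $A_1,\dots,A_n$, and governed in $\mathtt{SC}_\infty$ by the rules (I)–(IV) associated with this table. Then for all formulas $A_1,\dots,A_n$, $$\vdash F(A_1,\dots,A_n)\ \Leftrightarrow^{s}\ (\overline{S_{11}}\wedge\dots\wedge\overline{S_{1s_1}})\vee\dots\vee(\overline{S_{t1}}\wedge\dots\wedge\overline{S_{ts_t}}),$$ that is, writing $D$ for the formula on the right, the four $R$-expressions $F(A_1,\dots,A_n)\Rightarrow D$, $-D\Rightarrow -F(A_1,\dots,A_n)$, $D\Rightarrow F(A_1,\dots,A_n)$ and $-F(A_1,\dots,A_n)\Rightarrow -D$ are all derivable in $\mathtt{SC}_\infty$.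
   Context: **Language.** $L$ is a propositional language whose formulas are built from atoms (propositional letters) and a collection of connectives, each given by a table as described below; among the connectives are ${\sim}$ (unary) and $\wedge,\vee,\rightarrow$ (binary). **$R$-expressions** over $L$ are defined inductively: (1) every formula is an $R$-expression; (2) if $S$ is an $R$-expression not of the form $-T$, then $-S$ is an $R$-expression (read ''refutation of $S$''); (3) if $S_1,\dots,S_m,T$ are $R$-expressions ($m\ge 0$), so is $(S_1,\dots,S_m\Rightarrow T)$; nothing else is. Convention: if $S$ has the form $-T$, then $-S$ stands for $T$ (i.e. $--T$ stands for $T$). $\Gamma,\Delta,\dots$ denote finite, possibly empty, sequences of $R$-expressions. **Calculus $\mathtt{SC}_\infty$.** It derives $R$-expressions of the form $\Delta\Rightarrow S$. Rules (premises / conclusion), with $S,T,U$ arbitrary $R$-expressions: - RF: $S\Rightarrow S$ (axiom). - WL: $\Delta\Rightarrow S\ /\ \Delta,T\Rightarrow S$. - PL: $\Delta,S,T,\Gamma\Rightarrow U\ /\ \Delta,T,S,\Gamma\Rightarrow U$. - CL: $\Delta,S,S\Rightarrow T\ /\ \Delta,S\Rightarrow T$. - Cut: $\Delta\Rightarrow S$ and $\Delta,S\Rightarrow T\ /\ \Delta\Rightarrow T$. - RI$^+$: $\Gamma,\Delta\Rightarrow S\ /\ \Gamma\Rightarrow(\Delta\Rightarrow S)$. - LI$^+$: $\Gamma\Rightarrow\Delta$ and $\Gamma,S\Rightarrow T\ /\ \Gamma,(\Delta\Rightarrow S)\Rightarrow T$. - RI$^-$: $\Delta,\Gamma\Rightarrow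 -S\ /\ \Delta\Rightarrow -(\Gamma\Rightarrow S)$. - LI$^-$: $\Delta\Rightarrow\Gamma$ and $\Delta,-S\Rightarrow T\ /\ \Delta,-(\Gamma\Rightarrow S)\Rightarrow T$. Here a premise $\Gamma\Rightarrow\Delta$ with $\Delta=U_1,\dots,U_m$ abbreviates the $m$ premises $\Gamma\Rightarrow U_1,\ \dots,\ \Gamma\Rightarrow U_m$. **Rules for connectives.** Each $n$-ary connective $F$ comes with a table of $R$-expression schemata $S_{ik}$ ($i=1,\dots,t$; $k=1,\dots,s_i$; $t\ge1$, $s_i\ge 1$), each built from the formulas $A_1,\dots,A_n$ using only $-$ and $\Rightarrow$ (i.e. whose formula components are among $A_1,\dots,A_n$). The rules for $F$ are, for arbitrary $\Delta$, $T$: - (I) for each $i\in\{1,\dots,t\}$: $\Delta\Rightarrow S_{i1},\ \dots,\ \Delta\Rightarrow S_{is_i}\ /\ \Delta\Rightarrow F(A_1,\dots,A_n)$. - (II) from the $t$ premises $\Delta,S_{i1},\dots,S_{is_i}\Rightarrow T$ ($i=1,\dots,t$) infer $\Delta,F(A_1,\dots,A_n)\Rightarrow T$. - (III) for each choice $(k_1,\dots,k_t)$ with $k_i\in\{1,\dots,s_i\}$: $\Delta\Rightarrow -S_{1k_1},\ \dots,\ \Delta\Rightarrow -S_{tk_t}\ /\ \Delta\Rightarrow -F(A_1,\dots,A_n)$. - (IV) from the $r=s_1\times\dots\times s_t$ premises $\Delta,-S_{1k_1},\dots,-S_{tk_t}\Rightarrow T$ (one for each choice $(k_1,\dots,k_t)$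 with $k_i\in\{1,\dots,s_i\}$) infer $\Delta,-F(A_1,\dots,A_n)\Rightarrow T$. The standard connectives have these tables: ${\sim}A$: $t=1$, $s_1=1$, $S_{11}=-A$. $A\wedge B$: $t=1$, $s_1=2$, $S_{11}=A$, $S_{12}=B$. $A\vee B$: $t=2$, $s_1=s_2=1$, $S_{11}=A$, $S_{21}=B$. $A\rightarrow B$: $t=1$, $s_1=1$, $S_{11}=(A\Rightarrow B)$. **Derivability.** $\vdash \Delta\Rightarrow S$ means that $\Delta\Rightarrow S$ is derivable in $\mathtt{SC}_\infty$. $S\Rightarrow^{s}T$ stands for the two expressions $S\Rightarrow T$ and $-T\Rightarrow -S$; $S\Leftrightarrow^{s}T$ stands for $S\Rightarrow^{s}T$ together with $T\Rightarrow^{s}S$; $\vdash$ applied to such a collection means all its members are derivable. **Translation $\overline{S}$** of $R$-expressions to formulas: $\overline{A}=A$ for a formula $A$; $\overline{-S}={\sim}\overline{S}$ (for $S$ not of the form $-T$); $\overline{S_1,\dots,S_m\Rightarrow S}=(\overline{S_1}\wedge\dots\wedge\overline{S_m})\rightarrow\overline{S}$ for $m\ge1$; $\overline{\Rightarrow S}=\overline{S}$. Iterated conjunctions and disjunctions are bracketed in some fixed way (a one-term conjunction or disjunction is the term itself). *)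

(* Defs.v *)
From Stdlib Require List.
From mathcomp Require Import all_boot.
Set Implicit Arguments.
Unset Strict Implicit.
Unset Printing Implicit Defensive.

(* [rexp X]: R-expressions whose formula components are taken from [X];
   [uexp X]: those not of the form -T.  [X] is the type of formulas for the
   R-expressions of the language, and 'I_n for the schemata in A_1, ..., A_n. *)
Inductive rexp (X : Type) : Type :=
| Plain (u : uexp X)
| Minus (u : uexp X)
with uexp (X : Type) : Type :=
| Component (x : X)
| Sequent (G : seq (rexp X)) (S : rexp X).

Arguments Plain {X}.
Arguments Minus {X}.
Arguments Component {X}.
Arguments Sequent {X}.

(* -S, with --T standing for T *)
Definition refut X (S : rexp X) : rexp X :=
  match S with Plain u => Minus u | Minus u => Plain u end.

Notation "G '=>>' S" := (Plain (Sequent G S)) (at level 70, no associativity).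

Fixpoint map_rexp X Y (f : X -> Y) (S : rexp X) : rexp Y :=
  match S with
  | Plain u => Plain (map_uexp f u)
  | Minus u => Minus (map_uexp f u)
  end
with map_uexp X Y (f : X -> Y) (u : uexp X) : uexp Y :=
  match u with
  | Component x => Component (f x)
  | Sequent G T => Sequent (map (map_rexp f) G) (map_rexp f T)
  end.

(* [entry i k] is the schema S_ik (0-based), in the variables A_1, ..., A_n. *)
Record table (n : nat) := Table {
  height : nat;
  width : 'I_height -> nat;
  entry : forall i : 'I_height, 'I_(width i) -> rexp 'I_n;
  height_gt0 : 0 < height;
  width_gt0 : forall i, 0 < width i
}.

Arguments width {n t} i : rename.
Arguments entry {n t} i k : rename.
Arguments width_gt0 {n t} i : rename.

Definition neg_table : table 1 :=
  @Table 1 1 (fun=> 1) (fun _ _ => Minus (Component ord0)) isT (fun=> isT).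

Definition conj_table : table 2 :=
  @Table 2 1 (fun=> 2) (fun _ k => Plain (Component k)) isT (fun=> isT).

Definition disj_table : table 2 :=
  @Table 2 2 (fun=> 1) (fun i _ => Plain (Component i)) isT (fun=> isT).

Definition impl_table : table 2 :=
  @Table 2 1 (fun=> 1)
    (fun _ _ => [:: Plain (Component ord0)] =>> Plain (Component ord_max))
    isT (fun=> isT).

(* The connectives are the four standard ones together with an arbitrary
   collection [xconn] of further ones. *)
Record language := Language {
  atom : Type;
  xconn : Type;
  xarity : xconn -> nat;
  xtable : forall c : xconn, table (xarity c)
}.

Inductive conn (L : language) : Type :=
| CNeg | CConj | CDisj | CImpl
| CExtra (c : xconn L).

Arguments CNeg {L}.
Arguments CConj {L}.
Arguments CDisj {L}.
Arguments CImpl {L}.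

Definition arity (L : language) (F : conn L) : nat :=
  match F with
  | CNeg => 1
  | CConj | CDisj | CImpl => 2
  | CExtra c => xarity c
  end.

Definition conn_table (L : language) (F : conn L) : table (arity F) :=
  match F return table (arity F) with
  | CNeg => neg_table
  | CConj => conj_table
  | CDisj => disj_table
  | CImpl => impl_table
  | CExtra c => xtable c
  end.

Inductive formula (L : language) : Type :=
| Atom (p : atom L)
| App (F : conn L) (A : {ffun 'I_(arity F) -> formula L}).

Definition Neg (L : language) (A : formula L) : formula L :=
  @App L CNeg [ffun=> A].

Definition pair_args (L : language) (A B : formula L) :
    {ffun 'I_2 -> formula L} :=
  [ffun i : 'I_2 => if i == ord0 then A else B].

Definition Conj (L : language) (A B : formula L) : formula L :=
  @App L CConj (pair_args A B).
Definition Disj (L : language) (A B : formula L) : formula L :=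
  @App L CDisj (pair_args A B).
Definition Impl (L : language) (A B : formula L) : formula L :=
  @App L CImpl (pair_args A B).

Definition fml (L : language) (A : formula L) : rexp (formula L) :=
  Plain (Component A).

Definition inst (L : language) (F : conn L)
    (A : {ffun 'I_(arity F) -> formula L}) (S : rexp 'I_(arity F)) :
    rexp (formula L) :=
  map_rexp A S.

(* [sc E] is |- E in SC_infinity; every derivable E has the form G =>> S. *)
Inductive sc (L : language) : rexp (formula L) -> Prop :=
| sc_RF S : sc ([:: S] =>> S)
| sc_WL D S T : sc (D =>> S) -> sc (D ++ [:: T] =>> S)
| sc_PL D G S T U :
    sc (D ++ [:: S; T] ++ G =>> U) -> sc (D ++ [:: T; S] ++ G =>> U)
| sc_CL D S T : sc (D ++ [:: S; S] =>> T) -> sc (D ++ [:: S] =>> T)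
| sc_Cut D S T : sc (D =>> S) -> sc (D ++ [:: S] =>> T) -> sc (D =>> T)
| sc_RIp G D S : sc (G ++ D =>> S) -> sc (G =>> (D =>> S))
| sc_LIp G D S T :
    (forall U, List.In U D -> sc (G =>> U)) ->
    sc (G ++ [:: S] =>> T) -> sc (G ++ [:: D =>> S] =>> T)
| sc_RIm D G S : sc (D ++ G =>> refut S) -> sc (D =>> refut (G =>> S))
| sc_LIm D G S T :
    (forall U, List.In U G -> sc (D =>> U)) ->
    sc (D ++ [:: refut S] =>> T) -> sc (D ++ [:: refut (G =>> S)] =>> T)
| sc_I D (F : conn L) A (i : 'I_(height (conn_table F))) :
    (forall k : 'I_(width i), sc (D =>> inst A (entry i k))) ->
    sc (D =>> fml (App A))
| sc_II D (F : conn L) A T :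
    (forall i : 'I_(height (conn_table F)),
       sc (D ++ [seq inst A (entry i k) | k <- enum 'I_(width i)] =>> T)) ->
    sc (D ++ [:: fml (App A)] =>> T)
| sc_III D (F : conn L) A
    (k : forall i : 'I_(height (conn_table F)), 'I_(width i)) :
    (forall i, sc (D =>> refut (inst A (entry i (k i))))) ->
    sc (D =>> refut (fml (App A)))
| sc_IV D (F : conn L) A T :
    (forall k : (forall i : 'I_(height (conn_table F)), 'I_(width i)),
       sc (D ++ [seq refut (inst A (entry i (k i)))
                | i <- enum 'I_(height (conn_table F))] =>> T)) ->
    sc (D ++ [:: refut (fml (App A))] =>> T).

Definition strong_imp (L : language) (S T : rexp (formula L)) : Prop :=
  sc ([:: S] =>> T) /\ sc ([:: refut T] =>> refut S).

Definition strong_equiv (L : language) (S T : rexp (formula L)) : Prop :=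
  strong_imp S T /\ strong_imp T S.

(* Ways of bracketing an iterated binary operation with [n] terms. *)
Inductive btree : nat -> Type :=
| Leaf : btree 1
| Node m n (l : btree m) (r : btree n) : btree (m + n).

(* A fixed way of bracketing, for each positive number of terms. *)
Definition bracketing := forall n, 0 < n -> btree n.

Fixpoint bracket T (op : T -> T -> T) n (b : btree n) : ('I_n -> T) -> T :=
  match b in btree n return ('I_n -> T) -> T with
  | Leaf => fun f => f ord0
  | Node m n l r => fun f =>
      op (bracket op l (fun i => f (lshift n i)))
         (bracket op r (fun j => f (rshift m j)))
  end.

Definition iter_conj (L : language) (bc : bracketing) n (n_gt0 : 0 < n)
    (f : 'I_n -> formula L) : formula L :=
  bracket (@Conj L) (bc n n_gt0) f.

Definition iter_disj (L : language) (bd : bracketing) n (n_gt0 : 0 < n)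
    (f : 'I_n -> formula L) : formula L :=
  bracket (@Disj L) (bd n n_gt0) f.

Fixpoint trans (L : language) (bc : bracketing) (S : rexp (formula L)) :
    formula L :=
  match S with
  | Plain u => trans_uexp bc u
  | Minus u => Neg (trans_uexp bc u)
  end
with trans_uexp (L : language) (bc : bracketing) (u : uexp (formula L)) :
    formula L :=
  match u with
  | Component A => A
  | Sequent G T =>
      match map (trans bc) G with
      | [::] => trans bc T
      | B :: Bs =>
          Impl (iter_conj bc (ltn0Sn (size Bs)) (tnth (in_tuple (B :: Bs))))
               (trans bc T)
      end
  end.

(* The right-hand side D: the disjunction over i of the conjunctions over k of
   the translations of the S_ik. *)
Definition table_formula (L : language) (bc bd : bracketing) (F : conn L)
    (A : {ffun 'I_(arity F) -> formula L}) : formula L :=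
  iter_disj bd (height_gt0 (conn_table F))
    (fun i => iter_conj bc (width_gt0 i)
       (fun k => trans bc (inst A (entry i k)))).

(* Main.v *)
(** The rules make each connective interderivable with its table, both
    affirmed and refuted; in particular "-" agrees with ~ and "=>" with the
    implication, and -(G => S) is derivable from D exactly when -S is derivable
    from D, G.  Hence every R-expression S is interderivable with its
    translation, and likewise -S with the refutation of that translation.  The
    theorem follows by replacing each S_ik by its translation in the rules
    (I)-(IV) for F. *)
Require Import Defs.
From Stdlib Require Import List Permutation.
From mathcomp Require Import all_boot.

Set Implicit Arguments.
Unset Strict Implicit.
Unset Printing Implicit Defensive.

(** * Induction on R-expressions and membership in lists *)

(** An inner fixpoint over the antecedent [G] supplies hypotheses for its members. One predicate
    suffices for both mutual types: [Plain u] stands for [u], and [Minus u] is reduced to it. *)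
Lemma rexp_nested_ind X (P : rexp X -> Prop) :
  (forall x, P (Plain (Component x))) ->
  (forall G S, (forall U, List.In U G -> P U) -> P S -> P (G =>> S)) ->
  (forall u, P (Plain u) -> P (Minus u)) ->
  forall S, P S.
Proof.
move=> Pcomp Pseq Pminus.
refine (fix on_rexp S : P S := _).
pose on_uexp := fix on_uexp (u : uexp X) : P (Plain u) :=
  match u with
  | Component x => Pcomp x
  | Sequent G T => Pseq G T
      ((fix on_seq (G : seq (rexp X)) : forall U, List.In U G -> P U :=
         match G with
         | [::] => fun U inU => match inU with end
         | V :: G' => fun U inU =>
             match inU with
             | or_introl eqVU => match eqVU with erefl => on_rexp V end
             | or_intror inU' => on_seq G' U inU'
             end
         end) G) (on_rexp T)
  end.
case: S => u; first exact: on_uexp.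
exact: Pminus (on_uexp u).
Qed.

Lemma In_map_enum (I : finType) X (f : I -> X) i :
  List.In (f i) [seq f k | k <- enum I].
Proof.
have: i \in enum I by rewrite mem_enum.
elim: (enum I) => //= j s IHs; rewrite inE => /predU1P[->|/IHs]; first by left.
by right.
Qed.

Lemma In_cat X (s1 s2 : seq X) x :
  List.In x (s1 ++ s2) <-> List.In x s1 \/ List.In x s2.
Proof. exact: List.in_app_iff. Qed.

Lemma In_map X Y (f : X -> Y) s x : List.In x s -> List.In (f x) (map f s).
Proof.
by elim: s => //= y s IHs [->|/IHs]; [left|right].
Qed.

Lemma map_In X Y (f : X -> Y) s y :
  List.In y (map f s) -> exists2 x, List.In x s & f x = y.
Proof.
elim: s => //= x s IHs [<-|/IHs[z]]; first by exists x; first left.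
by exists z; first right.
Qed.

Lemma forall_tnth X (P : X -> Prop) (s : seq X) :
  (forall i, P (tnth (in_tuple s) i)) <-> (forall x, List.In x s -> P x).
Proof.
split=> [Ps | Ps i].
(* The head of a nonempty list serves as the default value of [nth]; the list is then generalized so
   that the induction keeps [x0] fixed. *)
- case: s Ps => // x0 s; move: (x0 :: s) => {}s Ps x.
  have {Ps}: forall i, i < size s -> P (nth x0 s i).
    by move=> i lt_i; have := Ps (Ordinal lt_i); rewrite (tnth_nth x0).
  elim: s => //= y s IHs Ps [<-|]; first exact: (Ps 0).
  by apply: IHs => i lt_i; apply: (Ps i.+1).
- apply: Ps; case: s i => [[]//|x0 s] i.
  rewrite (tnth_nth x0); case: i => i; rewrite [val _]/=.
  change (tval (in_tuple (x0 :: s))) with (x0 :: s).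
  move: (x0 :: s) => {}s; elim: s i => //= y s IHs [|i] lt_i; first by left.
  by right; apply: IHs.
Qed.

(** * Structural rules and inversion for sequents *)

Section Structural.

Variable L : language.
Implicit Types (D G : seq (rexp (formula L))) (S T U : rexp (formula L)).

Lemma sc_Permutation D G T : Permutation D G -> sc (D =>> T) -> sc (G =>> T).
Proof.
(* The prefix [C] absorbs the common head in the skip case of [Permutation]. *)
suff gen C : Permutation D G -> sc (C ++ D =>> T) -> sc (C ++ G =>> T).
  exact: (gen [::]).
move=> permDG; elim: permDG C => // {D G}.
- by move=> U D G _ IH C; rewrite -!cat_rcons; apply: IH.
- by move=> U V D C; apply: (sc_PL (D := C) (G := D)).
- by move=> D D1 G _ IH1 _ IH2 C /IH1/IH2.
Qed.

Lemma sc_rot_head D S T : sc (D ++ [:: S] =>> T) <-> sc (S :: D =>> T).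
Proof.
split; apply: sc_Permutation.
- by apply: Permutation_sym; apply: Permutation_cons_append.
- exact: Permutation_cons_append.
Qed.

Lemma sc_cat_comm D G T : sc (D ++ G =>> T) -> sc (G ++ D =>> T).
Proof. by apply: sc_Permutation; apply: Permutation_app_comm. Qed.

Lemma sc_contract D S T : List.In S D -> sc (S :: D =>> T) -> sc (D =>> T).
Proof.
move=> inS scT; have [D1 [D2 eqD]] := List.in_split _ _ inS.
rewrite {D inS}eqD in scT *.
apply: (@sc_Permutation ((D1 ++ D2) ++ [:: S])).
  rewrite -catA; apply: Permutation_app_head.
  exact/Permutation_sym/Permutation_cons_append.
apply: sc_CL; apply: sc_Permutation scT.
apply: Permutation_trans (_ : Permutation (S :: S :: (D1 ++ D2)) _).
  exact/perm_skip/Permutation_sym/Permutation_middle.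
exact: (Permutation_app_comm [:: S; S]).
Qed.

(** Antecedents behave as sets: weakening appends all of [G], then each member of [D] is contracted
    into its copy in [G]. *)
Lemma sc_incl D G T : List.incl D G -> sc (D =>> T) -> sc (G =>> T).
Proof.
move=> inclDG scT.
have: sc (D ++ G =>> T).
  elim: G {inclDG} D scT => [|U G IH] D scT; first by rewrite cats0.
  by rewrite -cat_rcons; apply: IH; rewrite -cats1; apply: sc_WL.
elim: D inclDG {scT} => // U D IH inclUDG scT.
have [inU inclDG] := List.incl_cons_inv inclUDG.
by apply: (IH inclDG); apply: sc_contract scT; apply/In_cat; right.
Qed.

Lemma sc_hyp D S : List.In S D -> sc (D =>> S).
Proof. by move=> inS; apply: sc_incl (sc_RF S) => U [<-|[]]. Qed.

Lemma sc_weak D S T : sc (D =>> T) -> sc (S :: D =>> T).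
Proof. by apply: sc_incl => U; right. Qed.

Lemma sc_cut D S T : sc (D =>> S) -> sc (S :: D =>> T) -> sc (D =>> T).
Proof. by move=> scS /sc_rot_head; apply: sc_Cut. Qed.

Lemma sc_multicut G D T :
  (forall U, List.In U G -> sc (D =>> U)) -> sc (G ++ D =>> T) -> sc (D =>> T).
Proof.
elim: G => //= U G IH scG scT; apply: IH => [V inV|].
  by apply: scG; right.
apply: sc_cut scT; apply: sc_incl (scG U (or_introl erefl)) => V inV.
by apply/In_cat; right.
Qed.

(** RI+ is inverted by a cut on [G =>> S], which LI+ then decomposes, the members of [G] being
    hypotheses. *)
Lemma sc_sequent D G S : sc (D =>> (G =>> S)) <-> sc (G ++ D =>> S).
Proof.
split=> [scS | /sc_cat_comm]; last exact: sc_RIp.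
apply: (@sc_cut _ (G =>> S)).
  by apply: sc_incl scS => U inU; apply/In_cat; right.
apply/sc_rot_head/sc_LIp => [U inU|].
  by apply: sc_hyp; apply/In_cat; left.
by apply/sc_rot_head/sc_hyp; left.
Qed.

Lemma sc_refut_sequent D G S :
  sc (D =>> refut (G =>> S)) <-> sc (G ++ D =>> refut S).
Proof.
split=> [scS | /sc_cat_comm]; last exact: sc_RIm.
apply: (@sc_cut _ (refut (G =>> S))).
  by apply: sc_incl scS => U inU; apply/In_cat; right.
apply/sc_rot_head/sc_LIm => [U inU|].
  by apply: sc_hyp; apply/In_cat; left.
by apply/sc_rot_head/sc_hyp; left.
Qed.

End Structural.

(** * Derived rules for the standard connectives *)

Section Connectives.

Variable L : language.
Implicit Types (D : seq (rexp (formula L))) (S T : rexp (formula L)).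
Implicit Types A B : formula L.

Lemma sc_App_l (F : conn L) (A : {ffun 'I_(arity F) -> formula L}) D T :
  (forall i : 'I_(height (conn_table F)),
     sc ([seq inst A (entry i k) | k <- enum 'I_(width i)] ++ D =>> T)) ->
  sc (fml (App A) :: D =>> T).
Proof.
by move=> scT; apply/sc_rot_head/sc_II => i; apply/sc_cat_comm.
Qed.

Lemma sc_refut_App_l (F : conn L) (A : {ffun 'I_(arity F) -> formula L}) D T :
  (forall k : (forall i : 'I_(height (conn_table F)), 'I_(width i)),
     sc ([seq refut (inst A (entry i (k i)))
         | i <- enum 'I_(height (conn_table F))] ++ D =>> T)) ->
  sc (refut (fml (App A)) :: D =>> T).
Proof.
by move=> scT; apply/sc_rot_head/sc_IV => k; apply/sc_cat_comm.
Qed.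

Lemma In_map_enum_cat (I : finType) X (f : I -> X) i x s :
  f i = x -> List.In x ([seq f k | k <- enum I] ++ s).
Proof.
by move=> <-; apply/In_cat; left; apply: In_map_enum.
Qed.

Lemma incl_cons_map_enum (I : finType) X (f : I -> X) i x s :
  f i = x -> List.incl (x :: s) ([seq f k | k <- enum I] ++ s).
Proof.
move=> fi y [<-|iny]; first exact: (In_map_enum_cat _ fi).
by apply/In_cat; right.
Qed.

(** One direction is rule (I). The other is a cut against rule (II): the table has a single entry,
    which becomes a hypothesis. *)
Lemma sc_Neg D A : sc (D =>> fml (Neg A)) <-> sc (D =>> refut (fml A)).
Proof.
split=> scA.
- apply: sc_cut scA _; apply: sc_App_l => i; apply: sc_hyp.
  by apply: (In_map_enum_cat (i := ord0)); rewrite /inst /= ffunE.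
- by apply: (sc_I (F := CNeg) (i := ord0)) => k; rewrite /inst /= ffunE.
Qed.

Lemma sc_refut_Neg D A : sc (D =>> refut (fml (Neg A))) <-> sc (D =>> fml A).
Proof.
split=> scA.
- apply: sc_cut scA _; apply: sc_refut_App_l => k; apply: sc_hyp.
  by apply: (In_map_enum_cat (i := ord0)); rewrite /inst /= ffunE.
- apply: (sc_III (F := CNeg) (k := fun=> ord0)) => i.
  by rewrite /inst /= ffunE.
Qed.

Lemma sc_Impl D A B :
  sc (D =>> fml (Impl A B)) <-> sc (fml A :: D =>> fml B).
Proof.
suff ->: sc (D =>> fml (Impl A B)) <-> sc (D =>> ([:: fml A] =>> fml B)).
  exact: sc_sequent.
split=> scA.
- apply: sc_cut scA _; apply: sc_App_l => i; apply: sc_hyp.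
  by apply: (In_map_enum_cat (i := ord0)); rewrite /inst /= !ffunE.
- by apply: (sc_I (F := CImpl) (i := ord0)) => k; rewrite /inst /= !ffunE.
Qed.

Lemma sc_refut_Impl D A B :
  sc (D =>> refut (fml (Impl A B))) <-> sc (fml A :: D =>> refut (fml B)).
Proof.
suff ->: sc (D =>> refut (fml (Impl A B))) <->
         sc (D =>> refut ([:: fml A] =>> fml B)).
  exact: sc_refut_sequent.
split=> scA.
- apply: sc_cut scA _; apply: sc_refut_App_l => k; apply: sc_hyp.
  by apply: (In_map_enum_cat (i := ord0)); rewrite /inst /= !ffunE.
- apply: (sc_III (F := CImpl) (k := fun=> ord0)) => i.
  by rewrite /inst /= !ffunE.
Qed.

Lemma sc_Conj D A B :
  sc (D =>> fml (Conj A B)) <-> sc (D =>> fml A) /\ sc (D =>> fml B).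
Proof.
split=> [scAB | [scA scB]].
- split; apply: sc_cut scAB _; apply: sc_App_l => i; apply: sc_hyp.
  + by apply: (In_map_enum_cat (i := ord0)); rewrite /inst /= ffunE.
  + by apply: (In_map_enum_cat (i := ord_max)); rewrite /inst /= ffunE.
- apply: (sc_I (F := CConj) (i := ord0)) => k; rewrite /inst /= ffunE.
  by case: ifP.
Qed.

(** Every row has one entry, so (IV) has essentially one premise, with both refuted disjuncts among
    its antecedents. *)
Lemma sc_refut_Disj D A B :
  sc (D =>> refut (fml (Disj A B))) <->
  sc (D =>> refut (fml A)) /\ sc (D =>> refut (fml B)).
Proof.
split=> [scAB | [scA scB]].
- split; apply: sc_cut scAB _; apply: sc_refut_App_l => i; apply: sc_hyp.
  + by apply: (In_map_enum_cat (i := ord0)); rewrite /inst /= ffunE.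
  + by apply: (In_map_enum_cat (i := ord_max)); rewrite /inst /= ffunE.
- apply: (sc_III (F := CDisj) (k := fun=> ord0)) => i; rewrite /inst /= ffunE.
  by case: ifP.
Qed.

(** Rule (II) is inverted by a cut against rule (I). The equivalence turns a disjunction into a
    meta-level conjunction, the form that iterates over a bracketing. *)
Lemma sc_Disj_l D A B T :
  sc (fml (Disj A B) :: D =>> T) <->
  sc (fml A :: D =>> T) /\ sc (fml B :: D =>> T).
Proof.
have cut_l C : sc (fml (Disj A B) :: D =>> T) ->
    sc (fml C :: D =>> fml (Disj A B)) -> sc (fml C :: D =>> T).
  move=> scT scAB; apply: sc_cut scAB _; apply: sc_incl scT => U [<-|inU].
    by left.
  by right; right.
split=> [scT | [scA scB]].
- split; apply: cut_l scT _.
  + apply: (sc_I (F := CDisj) (i := ord0)) => k; rewrite /inst /= ffunE.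
    by apply: sc_hyp; left.
  + apply: (sc_I (F := CDisj) (i := ord_max)) => k; rewrite /inst /= ffunE.
    by apply: sc_hyp; left.
- apply: sc_App_l => i; have [i0|i0] := boolP (i == ord0).
  + apply: sc_incl scA; apply: (incl_cons_map_enum (i := ord0)).
    by rewrite /inst /= ffunE i0.
  + apply: sc_incl scB; apply: (incl_cons_map_enum (i := ord0)).
    by rewrite /inst /= ffunE (negPf i0).
Qed.

Lemma sc_refut_Conj_l D A B T :
  sc (refut (fml (Conj A B)) :: D =>> T) <->
  sc (refut (fml A) :: D =>> T) /\ sc (refut (fml B) :: D =>> T).
Proof.
have cut_l C : sc (refut (fml (Conj A B)) :: D =>> T) ->
    sc (refut (fml C) :: D =>> refut (fml (Conj A B))) ->
    sc (refut (fml C) :: D =>> T).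
  move=> scT scAB; apply: sc_cut scAB _; apply: sc_incl scT => U [<-|inU].
    by left.
  by right; right.
split=> [scT | [scA scB]].
- split; apply: cut_l scT _.
  + apply: (sc_III (F := CConj) (k := fun=> ord0)) => i; rewrite /inst /= ffunE.
    by apply: sc_hyp; left.
  + apply: (sc_III (F := CConj) (k := fun=> ord_max)) => i.
    by rewrite /inst /= ffunE; apply: sc_hyp; left.
(* The value of the choice at the only row tells which conjunct is refuted. *)
- apply: sc_refut_App_l => k; have [k0|k0] := boolP (k ord0 == ord0).
  + apply: sc_incl scA; apply: (incl_cons_map_enum (i := ord0)).
    by rewrite /inst /= ffunE k0.
  + apply: sc_incl scB; apply: (incl_cons_map_enum (i := ord0)).
    by rewrite /inst /= ffunE (negPf k0).
Qed.

End Connectives.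

(** * Iterated conjunctions and disjunctions *)

(** Makes the bracketing irrelevant, at once for affirmed conjunctions and refuted disjunctions on
    the right and for their duals on the left. *)
Lemma forall_bracket X (P : X -> Prop) (op : X -> X -> X) :
  (forall x y, P (op x y) <-> P x /\ P y) ->
  forall n (b : btree n) f, P (bracket op b f) <-> (forall i, P (f i)).
Proof.
move=> P_op n; elim=> [|m {}n l IHl r IHr] f /=.
  by split=> [P0 i | //]; rewrite ord1.
rewrite P_op IHl IHr; split=> [[Pl Pr] i | Pf]; last by split=> i.
by rewrite -(splitK i); case: (split i).
Qed.

Section Iterated.

Variables (L : language) (b : bracketing) (n : nat) (n_gt0 : 0 < n).
Variable f : 'I_n -> formula L.
Implicit Types (D : seq (rexp (formula L))) (T : rexp (formula L)).

Lemma sc_iter_conj D :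
  sc (D =>> fml (iter_conj b n_gt0 f)) <-> (forall i, sc (D =>> fml (f i))).
Proof.
apply: (forall_bracket (P := fun A => sc (D =>> fml A))) => A B.
exact: sc_Conj.
Qed.

Lemma sc_refut_iter_disj D :
  sc (D =>> refut (fml (iter_disj b n_gt0 f))) <->
  (forall i, sc (D =>> refut (fml (f i)))).
Proof.
apply: (forall_bracket (P := fun A => sc (D =>> refut (fml A)))) => A B.
exact: sc_refut_Disj.
Qed.

Lemma sc_iter_disj_l D T :
  sc (fml (iter_disj b n_gt0 f) :: D =>> T) <->
  (forall i, sc (fml (f i) :: D =>> T)).
Proof.
apply: (forall_bracket (P := fun A => sc (fml A :: D =>> T))) => A B.
exact: sc_Disj_l.
Qed.

Lemma sc_refut_iter_conj_l D T :
  sc (refut (fml (iter_conj b n_gt0 f)) :: D =>> T) <->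
  (forall i, sc (refut (fml (f i)) :: D =>> T)).
Proof.
apply: (forall_bracket (P := fun A => sc (refut (fml A) :: D =>> T))) => A B.
exact: sc_refut_Conj_l.
Qed.

Lemma sc_iter_disj D i :
  sc (D =>> fml (f i)) -> sc (D =>> fml (iter_disj b n_gt0 f)).
Proof.
(* With all [i] treated together, the left rule for the disjunction reduces the goal to an axiom. *)
move=> scf; apply: sc_cut scf _; move: i; apply/sc_iter_disj_l.
by apply: sc_hyp; left.
Qed.

Lemma sc_refut_iter_conj D i :
  sc (D =>> refut (fml (f i))) -> sc (D =>> refut (fml (iter_conj b n_gt0 f))).
Proof.
move=> scf; apply: sc_cut scf _; move: i; apply/sc_refut_iter_conj_l.
by apply: sc_hyp; left.
Qed.

End Iterated.

(** * Interderivability with the translation *)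

(** Contraposition is not among the rules, so the refuted half is carried along in the induction. *)
Definition interderivable (L : language) (S T : rexp (formula L)) : Prop :=
  forall D, (sc (D =>> S) <-> sc (D =>> T)) /\
            (sc (D =>> refut S) <-> sc (D =>> refut T)).

Lemma trans_interderivable (L : language) bc (S : rexp (formula L)) :
  interderivable S (fml (trans bc S)).
Proof.
elim/rexp_nested_ind: S => [A D | G S IHG IHS D | u IHu D].
- by [].
- rewrite sc_sequent sc_refut_sequent.
  case: G IHG => [|U G] IHG; first exact: IHS.
  pose C := iter_conj bc (ltn0Sn _) (tnth (in_tuple (map (trans bc) (U :: G)))).
  change (trans bc ((U :: G) =>> S)) with (Impl C (trans bc S)).
  have scC D' : sc (D' =>> fml C) <->
      (forall V, List.In V (U :: G) -> sc (D' =>> V)).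
    rewrite sc_iter_conj.
    have -> := forall_tnth (fun B => sc (D' =>> fml B))
                           (map (trans bc) (U :: G)).
    split=> [scG V inV | scG B inB].
      by have [-> _] := IHG V inV D'; apply/scG/(In_map (trans bc)).
    by have [V inV <-] := map_In inB; have [<- _] := IHG V inV D'; apply: scG.
  (* As antecedents, the list and its translated conjunction [C] derive each other, so cuts exchange
     them. *)
  have replace T : sc ((U :: G) ++ D =>> T) <-> sc (fml C :: D =>> T).
    split=> scT.
    - apply: (@sc_multicut _ (U :: G)).
        by apply/scC/sc_hyp; left.
      apply: sc_incl scT => V /In_cat[inV|inV]; first by apply/In_cat; left.
      by apply/In_cat; right; right.
    - apply: (@sc_cut _ _ (fml C)).
        by apply/scC => V inV; apply/sc_hyp/In_cat; left.
      apply: sc_incl scT => V [<-|inV]; first by left.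
      by right; apply/In_cat; right.
  have [IHp _] := IHS (fml C :: D); have [_ IHm] := IHS (fml C :: D).
  by rewrite sc_Impl sc_refut_Impl !replace.
(* Passing from [Plain u] to [Minus u] swaps the two halves, on the formula side through [Neg]. *)
- have [IHp IHm] := IHu D.
  by split; [rewrite sc_Neg | rewrite sc_refut_Neg].
Qed.

Theorem theorem6p2 (L : language) (bc bd : bracketing) (F : conn L)
    (A : {ffun 'I_(arity F) -> formula L}) :
  strong_equiv (fml (App A)) (fml (table_formula bc bd A)).
Proof.
have tr (S : rexp (formula L)) D : sc (D =>> S) <-> sc (D =>> fml (trans bc S)).
  by case: (trans_interderivable bc S D).
have trN (S : rexp (formula L)) D :
    sc (D =>> refut S) <-> sc (D =>> refut (fml (trans bc S))).
  by case: (trans_interderivable bc S D).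
split; split.
- apply: sc_App_l => i; apply: (@sc_iter_disj _ _ _ _ _ _ i).
  apply/sc_iter_conj => k; rewrite -tr.
  by apply: sc_hyp; apply: (In_map_enum_cat (i := k)).
- set DF := refut (fml (table_formula bc bd A)).
  have DF_conj : forall i, _ :=
    proj1 (sc_refut_iter_disj _ _ _ _) (sc_RF DF).
  (* Splitting the cases of the refuted conjunctions one row at a time, the
     rows outside [s] have already had a refuted entry [S_ik] selected. *)
  suff select (s : seq 'I_(height (conn_table F))) D :
      List.In DF D ->
      (forall i, i \in s \/ exists k, sc (D =>> refut (inst A (entry i k)))) ->
      sc (D =>> refut (fml (App A))).
    apply: (select (enum 'I_(height (conn_table F)))) => [|i]; first by left.
    by left; rewrite mem_enum.
  elim: s D => [|i s IHs] D inDF sel.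
    have sel_all (i : 'I_(height (conn_table F))) :
        exists k, sc (D =>> refut (inst A (entry i k))).
      by case: (sel i).
    (* Once every row has a refuted entry, finite choice yields the selection that rule (III)
       requires. *)
    by have [k sck] := fin_all_exists sel_all; apply: sc_III sck.
  apply: (sc_cut (S := refut (fml (iter_conj bc (width_gt0 i)
                         (fun k => trans bc (inst A (entry i k))))))).
    by apply: sc_incl (DF_conj i) => U [<-|[]].
  apply/sc_refut_iter_conj_l => k; apply: IHs => [|j]; first by right.
  (* Earlier selections survive weakening; row [i] now gets the entry [k], and the other rows stay
     pending in [s]. *)
  have [|[k' sck']] := sel j; last by right; exists k'; apply: sc_weak.
  rewrite inE => /predU1P[->|js]; last by left.
  by right; exists k; rewrite trN; apply: sc_hyp; left.
- apply/sc_iter_disj_l => i; apply: (sc_I (i := i)) => k; rewrite tr.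
  move: k; apply/(sc_iter_conj bc (width_gt0 i)).
  by apply: sc_hyp; left.
(* The choice [k] from (IV) names, in each row [i], the refuted entry that refutes the conjunction
   of that row. *)
- apply: sc_refut_App_l => k; apply/sc_refut_iter_disj => i.
  apply: (@sc_refut_iter_conj _ _ _ _ _ _ (k i)); rewrite -trN.
  by apply: sc_hyp; apply: (In_map_enum_cat (i := i)).
Qed.
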